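(* Let $m,n$ be positive integers, let $w_1,\dots,w_n$ be the weights generated by the uniform balls and bins process with $m$ balls and $n$ bins, and let $M=\frac{m}{3n^3}$. Let $q\in(0,m]$ be a real quota such that $\left|q-\frac{\ell m}{n}\right|>\frac{1}{\sqrt{M}}\cdot\frac{m}{n}$ for all integers $\ell$. Then with probability at least $1-2\left(\frac{2}{e}\right)^n$ (over the generation of the weights), all Shapley values $\varphi_1,\dots,\varphi_n$ of the weighted voting game with weights $w_1,\dots,w_n$ and quota $q$ are equal to $1/n$.
   Context: Uniform balls and bins process: each of $m$ balls is thrown independently into one of $n$ bins, each bin having probability $1/n$; the weights $w_1\le\dots\le w_n$ are the resulting bin loads sorted in non-decreasing order (loads may be $0$). Weighted voting game with agents $N=\{1,\dots,n\}$, weights $w_i$ and quota $q$: for $S\subseteq N$ let $w(S)=\sum_{i\in S}w_i$; $v(S)=1$ ($S$ is winning) if $w(S)\ge q$, and $v(S)=0$ otherwise. Shapley value: $\varphi_i=\frac1{n!}\sum_{\sigma}\left(v(P_i(\sigma)\cup\{i\})-v(P_i(\sigma))\right)$, the sum over all permutations $\sigma$ of $N$, where $P_i(\sigma)=\{j\in N:\sigma(j)<\sigma(i)\}$. *)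

(* Defs.v *)
From HB Require Import structures.
From mathcomp Require Import all_boot all_order all_fingroup all_algebra.
From mathcomp Require Import reals.

Set Implicit Arguments.
Unset Strict Implicit.
Unset Printing Implicit Defensive.

Import Order.TTheory GRing.Theory Num.Theory.
Local Open Scope ring_scope.

(** * Uniform balls and bins

    An outcome of the process is the map sending each ball to its bin.  The
    throws are independent and each bin has probability [1/n], so the law on
    outcomes is the product of [m] uniform laws on ['I_n]. *)

Definition outcome (m n : nat) := {ffun 'I_m -> 'I_n}.

Definition bin_prob (R : realType) (n : nat) (j : 'I_n) : R := 1 / n%:R.

Definition mass (R : realType) (m n : nat) (f : outcome m n) : R :=
  \prod_(b < m) bin_prob R (f b).

Definition Pr (R : realType) (m n : nat) (E : pred (outcome m n)) : R :=
  \sum_(f : outcome m n | E f) mass R f.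

Definition load (m n : nat) (f : outcome m n) (j : 'I_n) : nat :=
  #|[set b : 'I_m | f b == j]|.

(** The list being sorted has length [n], so the default of [nth] is never
    reached. *)
Definition weights (R : realType) (m n : nat) (f : outcome m n) (i : 'I_n) : R :=
  (nth 0%N (sort leq [seq load f j | j : 'I_n]) i)%:R.

(** * Weighted voting games and the Shapley value

    Agents are numbered from [0]. *)

Definition wsum (R : realType) (n : nat) (w : 'I_n -> R) (S : {set 'I_n}) : R :=
  \sum_(i in S) w i.

Definition winning (R : realType) (n : nat) (w : 'I_n -> R) (q : R)
    (S : {set 'I_n}) : bool := q <= wsum w S.

Definition value (R : realType) (n : nat) (w : 'I_n -> R) (q : R)
    (S : {set 'I_n}) : R := if winning w q S then 1 else 0.

Definition predecessors (n : nat) (s : 'S_n) (i : 'I_n) : {set 'I_n} :=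
  [set j | (s j < s i)%N].

Definition shapley (R : realType) (n : nat) (w : 'I_n -> R) (q : R)
    (i : 'I_n) : R :=
  (n`!)%:R^-1 *
  \sum_(s : 'S_n) (value w q (predecessors s i :|: [set i])
                   - value w q (predecessors s i)).

(* Main.v *)
(** The deviation [(1 / sqrt M) * (m / n)] allowed by the hypothesis is
    [d = sqrt (3 n m)].  A Chernoff bound with parameter [t = d / (2 m)] shows
    that a fixed set of bins [S] receives [|S| m / n + d] balls or more with
    probability at most [e^-n], so by a union bound over the [2^n] sets,
    outside an event of probability at most [(2 / e)^n] every [S] receives
    fewer.  Applied to [S] and to its complement this puts every load within
    [d] of [|S| m / n]; since [q] is further than [d] from all these values,
    whether a coalition wins depends on its cardinality alone, and a symmetric
    game gives every agent the same Shapley value. *)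

Require Import Defs.
From mathcomp Require Import all_boot all_order all_fingroup all_algebra.
From mathcomp Require Import reals sequences exp.
From mathcomp Require Import ring lra.

Set Implicit Arguments.
Unset Strict Implicit.
Unset Printing Implicit Defensive.

Import Order.TTheory GRing.Theory Num.Theory.
Local Open Scope ring_scope.

(** From [1 - x <= expR (- x)] one gets [(1 - x) * expR x <= 1], while
    [(1 - x) * (1 + x + 2 * x ^+ 2)] is [1 + x ^+ 2 * (1 - 2 * x)], hence at least 1. *)
Lemma expR_le_quadratic (R : realType) (x : R) :
  x <= 1 / 2 -> expR x <= 1 + x + 2 * x ^+ 2.
Proof.
move=> hx.
have h1 : 1 - x <= expR (- x) by exact: expR_ge1Dx.
have h2 : (1 - x) * expR x <= 1.
  by rewrite -[leRHS](expRxMexpNx_1 x) mulrC ler_wpM2l ?expR_ge0.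
have h3 : 0 < 1 - x by lra.
rewrite -(ler_pM2l h3) (le_trans h2) //.
have : 0 <= x ^+ 2 * (1 - 2 * x) by rewrite mulr_ge0 ?sqr_ge0 //; lra.
lra.
Qed.

(** In the quadratic bounds the linear terms cancel and the rest is [2 * t ^+ 2 * p * (1 - p)], at
    most [t ^+ 2 / 2]. *)
Lemma centered_bernoulli_mgf (R : realType) (p t : R) :
  0 <= p -> p <= 1 -> 0 <= t -> t <= 1 / 2 ->
  p * expR (t * (1 - p)) + (1 - p) * expR (t * - p) <= expR (t ^+ 2 / 2).
Proof.
move=> p0 p1 t0 t1.
have e1 : expR (t * (1 - p)) <= 1 + t * (1 - p) + 2 * (t * (1 - p)) ^+ 2.
  by apply: expR_le_quadratic; nra.
have e2 : expR (t * - p) <= 1 + t * - p + 2 * (t * - p) ^+ 2.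
  by apply: expR_le_quadratic; nra.
have p1' : 0 <= 1 - p by lra.
apply: le_trans (expR_ge1Dx _).
apply: le_trans (lerD (ler_wpM2l p0 e1) (ler_wpM2l p1' e2)) _.
have : 0 <= t ^+ 2 * (1 - 2 * p) ^+ 2 by rewrite mulr_ge0 ?sqr_ge0.
lra.
Qed.

Lemma sum_prod_outcome (R : realType) (m n : nat) (F : 'I_n -> R) :
  \sum_(f : outcome m n) \prod_(b < m) F (f b) = (\sum_(j < n) F j) ^+ m.
Proof. by rewrite -(bigA_distr_bigA (fun _ : 'I_m => F)) prodr_const card_ord. Qed.

Lemma mass_ge0 (R : realType) (m n : nat) (f : outcome m n) : 0 <= mass R f.
Proof. by apply: prodr_ge0 => b _; rewrite /bin_prob divr_ge0 ?ler0n. Qed.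

Lemma sum_mass (R : realType) (m n : nat) :
  (0 < n)%N -> \sum_(f : outcome m n) mass R f = 1.
Proof.
move=> hn; rewrite /mass (sum_prod_outcome m (@bin_prob R n)) /bin_prob.
rewrite sumr_const card_ord -[_ *+ n]mulr_natr mulfVK ?expr1n //.
by rewrite pnatr_eq0 -lt0n.
Qed.

Lemma PrC (R : realType) (m n : nat) (E : pred (outcome m n)) :
  (0 < n)%N -> Pr R E = 1 - Pr R (predC E).
Proof.
by move=> hn; rewrite -(sum_mass R m hn) (bigID E) /= /Pr addrK.
Qed.

Lemma le_Pr (R : realType) (m n : nat) (E F : pred (outcome m n)) :
  (forall f, E f -> F f) -> Pr R E <= Pr R F.
Proof.
move=> EF; rewrite /Pr [leRHS](bigID E) /=.
rewrite (eq_bigl E) => [|f]; last by case Ef: (E f); rewrite ?andbF // andbT EF.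
by rewrite lerDl sumr_ge0 // => f _; exact: mass_ge0.
Qed.

Lemma Pr_exists_le (R : realType) (m n : nat) (T : finType)
    (E : T -> pred (outcome m n)) :
  Pr R (fun f => [exists x, E x f]) <= \sum_x Pr R (E x).
Proof.
rewrite /Pr; under [leRHS]eq_bigr do rewrite big_mkcond /=.
rewrite exchange_big big_mkcond /=; apply: ler_sum => f _.
have ge0 x : 0 <= (if E x f then mass R f else 0).
  by case: ifP => // _; exact: mass_ge0.
case: existsP => [[x Ex]|_]; last by rewrite sumr_ge0.
by rewrite (bigD1 x) //= Ex lerDl sumr_ge0.
Qed.

(** Counting by balls instead of bins gives a sum of independent indicators, so that exponential
    moments factor. *)
Lemma wsum_load (R : realType) (m n : nat) (f : outcome m n) (S : {set 'I_n}) :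
  wsum (fun j => (load f j)%:R : R) S = \sum_(b < m) (f b \in S)%:R.
Proof.
rewrite /wsum /load.
under eq_bigr => j _ do rewrite -sum1_card natr_sum big_mkcond /=.
rewrite exchange_big /=; apply: eq_bigr => b _.
under eq_bigr => j _ do rewrite inE.
rewrite -big_mkcondr /=; case: (boolP (f b \in S)) => fbS.
  rewrite (eq_bigl (pred1 (f b))) ?big_pred1_eq // => j /=.
  by rewrite eq_sym; case: eqP => [->|]; rewrite ?fbS ?andbF.
by rewrite big_pred0 // => j; case: eqP => [<-|]; rewrite ?andbF ?(negPf fbS).
Qed.

Lemma wsum_load_setC (R : realType) (m n : nat) (f : outcome m n)
    (S : {set 'I_n}) :
  wsum (fun j => (load f j)%:R : R) S +
  wsum (fun j => (load f j)%:R : R) (~: S) = m%:R.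
Proof.
rewrite !wsum_load -big_split /= -[m in RHS]card_ord -sum1_card natr_sum.
by apply: eq_bigr => b _; rewrite inE; case: (f b \in S); rewrite ?addr0 ?add0r.
Qed.

(** Mass and exponential both factor over the balls, so the sum is the [m]-th power of a one-ball
    sum, the moment generating function of a centred Bernoulli variable with parameter [p]. *)
Lemma load_mgf (R : realType) (m n : nat) (S : {set 'I_n}) (t : R) :
  (0 < n)%N -> 0 <= t -> t <= 1 / 2 ->
  \sum_(f : outcome m n) mass R f *
     expR (t * (wsum (fun j => (load f j)%:R) S - #|S|%:R * m%:R / n%:R))
  <= expR (m%:R * (t ^+ 2 / 2)).
Proof.
move=> hn t0 t1; have n0 : (n%:R : R) != 0 by rewrite pnatr_eq0 -lt0n.
set p : R := #|S|%:R / n%:R.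
pose F (j : 'I_n) : R := bin_prob R j * expR (t * ((j \in S)%:R - p)).
rewrite (eq_bigr (fun f : outcome m n => \prod_(b < m) F (f b))); last first.
  move=> f _; rewrite big_split /= -expR_sum -mulr_sumr sumrB sumr_const.
  by rewrite card_ord -wsum_load mulrAC mulr_natr.
rewrite sum_prod_outcome expRM_natl.
have F0 j : 0 <= F j by rewrite mulr_ge0 ?expR_ge0 // /bin_prob divr_ge0 ?ler0n.
have p0 : 0 <= p by rewrite divr_ge0 ?ler0n.
have p1 : p <= 1.
  by rewrite ler_pdivrMr ?ltr0n // mul1r ler_nat -[leqRHS]card_ord max_card.
apply: lerXn2r; rewrite ?nnegrE ?expR_ge0 ?sumr_ge0 //.
apply: le_trans (centered_bernoulli_mgf p0 p1 t0 t1).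
(* The bins inside [S] have total probability [p], those outside [1 - p]. *)
rewrite (bigID (mem S)) /=.
rewrite (eq_bigr (fun=> n%:R^-1 * expR (t * (1 - p)))); last first.
  by move=> j jS; rewrite /F /bin_prob jS div1r.
rewrite [X in _ + X](eq_bigr (fun=> n%:R^-1 * expR (t * - p))); last first.
  by move=> j /negPf jS; rewrite /F /bin_prob jS div1r sub0r.
rewrite !sumr_const [X in _ + _ *+ X](_ : _ = (n - #|S|)%N); last first.
  by apply: (canRL (addKn _)); have := cardC (mem S); rewrite card_ord.
rewrite -[X in X + _]mulr_natl -[X in _ + X]mulr_natl natrB; last first.
  by rewrite -[leqRHS]card_ord max_card.
by rewrite !mulrA mulrBl divff.
Qed.

Lemma load_upper_tail (R : realType) (m n : nat) (S : {set 'I_n}) (d : R) :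
  (0 < n)%N -> 0 <= d -> d <= m%:R -> (0 < m)%N ->
  d ^+ 2 = 3 * n%:R * m%:R ->
  Pr R (fun f : outcome m n =>
    #|S|%:R * m%:R / n%:R + d <= wsum (fun j => (load f j)%:R) S)
  <= expR (- n%:R).
Proof.
move=> hn d0 dm hm d2; have m0 : 0 < m%:R :> R by rewrite ltr0n.
(* Half the minimiser [d / m] of [m * t ^+ 2 / 2 - t * d], so that [d <= m] yields [t <= 1 / 2]. The
   exponent becomes [3n/8 - 3n/2 = -9n/8]. *)
pose t : R := d / (2 * m%:R).
have t0 : 0 <= t by rewrite divr_ge0 // mulr_ge0 ?ler0n.
have t1 : t <= 1 / 2 by rewrite ler_pdivrMr; lra.
have td : t * d = 3 / 2 * n%:R.
  by rewrite /t mulrAC -expr2 d2; field; rewrite gt_eqF.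
have mt2 : m%:R * (t ^+ 2 / 2) = 3 / 8 * n%:R.
  by rewrite /t expr_div_n d2; field; rewrite gt_eqF.
apply: (@le_trans _ _ (expR (- (t * d)) * expR (m%:R * (t ^+ 2 / 2)))); last first.
  by rewrite -expRD ler_expR td mt2; have := ler0n R n; lra.
apply: le_trans (ler_wpM2l (expR_ge0 _) (load_mgf m S hn t0 t1)).
(* Markov's inequality, outcome by outcome: on the event the combined exponential is at least 1,
   elsewhere it is nonnegative. *)
rewrite mulr_sumr /Pr big_mkcond /=; apply: ler_sum => f _.
have f0 := mass_ge0 R f; rewrite mulrCA -expRD.
case: ifP => hf; last by rewrite mulr_ge0 ?expR_ge0.
by rewrite ler_peMr // -[leLHS]expR0 ler_expR addrC -mulrBr mulr_ge0 // subr_ge0 lerBrDl.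
Qed.

(** The position of [i] is uniform: composing with a transposition shows that the sum is the same
    for every agent, and over all agents each permutation contributes the full sum of [h]. *)
Lemma sum_perm_eval (R : realType) (n : nat) (h : nat -> R) (i : 'I_n) :
  n%:R * \sum_(s : 'S_n) h (s i) = n`!%:R * \sum_(k < n) h k.
Proof.
have sym j : \sum_(s : 'S_n) h (s j) = \sum_(s : 'S_n) h (s i).
  rewrite (reindex_inj (mulgI (tperm i j))) /=.
  by apply: eq_bigr => s _; rewrite permM tpermR.
transitivity (\sum_(j < n) \sum_(s : 'S_n) h (s j)).
  by rewrite (eq_bigr _ (fun j _ => sym j)) sumr_const card_ord mulr_natl.
rewrite exchange_big /= (eq_bigr (fun=> \sum_(k < n) h k)) => [|s _].
  by rewrite sumr_const card_Sn mulr_natl.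
by rewrite [RHS](reindex_inj (@perm_inj _ s)).
Qed.

Lemma card_predecessors (n : nat) (s : 'S_n) (i : 'I_n) :
  #|predecessors s i| = s i.
Proof.
rewrite -(card_imset _ (@perm_inj _ s)).
have -> : s @: predecessors s i = [set k : 'I_n | (k < s i)%N].
  apply/setP => k; rewrite inE; apply/imsetP/idP => [[j]|ki].
    by rewrite inE => ji ->.
  by exists ((s^-1)%g k); rewrite ?inE permKV.
rewrite -sum1_card; under eq_bigl do rewrite inE.
by rewrite -(big_ord_widen n (fun=> 1%N) (ltnW (ltn_ord (s i)))) sum1_card card_ord.
Qed.

(** The marginal contribution of [i] depends only on its position [k], as [g k.+1 - g k]; averaging
    over uniform positions telescopes. *)
Lemma shapley_symmetric (R : realType) (n : nat) (w : 'I_n -> R) (q : R)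
    (g : nat -> R) (i : 'I_n) :
  (forall S, value w q S = g #|S|) ->
  shapley w q i = (g n - g 0%N) / n%:R.
Proof.
move=> wg; have hn : (0 < n)%N by case: n i {w wg} => [[]|].
have n0 : n%:R != 0 :> R by rewrite pnatr_eq0 -lt0n.
rewrite /shapley (eq_bigr (fun s : 'S_n => g (s i).+1 - g (s i))) => [|s _].
  have := @sum_perm_eval R n (fun k => g k.+1 - g k) i.
  rewrite -(big_mkord xpredT (fun k => g k.+1 - g k)) telescope_sumr // => E.
  apply: (mulfI n0); rewrite mulrCA E mulKf ?pnatr_eq0 -?lt0n ?fact_gt0 //.
  by rewrite mulrC divfK.
rewrite !wg setUC cardsU1 inE ltnn card_predecessors //.
Qed.

Lemma weights_perm (R : realType) (m n : nat) (f : outcome m n) :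
  exists s : 'S_n, forall i, weights R f i = (load f (s i))%:R.
Proof.
pose L := [tuple load f j | j < n].
have sz : size (sort leq L) == n by rewrite size_sort size_tuple.
have /tuple_permP [s Es] : perm_eq (Tuple sz) L by rewrite perm_sort.
exists s => i; rewrite /weights.
have -> : [seq load f j | j : 'I_n] = L by [].
by rewrite [sort _ _]Es -tnth_nth !tnth_mktuple.
Qed.

(** Sorting only permutes the loads, so a coalition corresponds to a set of bins of the same
    cardinality, and bounds valid for all sets of bins carry over. *)
Lemma wsum_weights (R : realType) (m n : nat) (f : outcome m n) :
  exists s : 'S_n, forall S,
  wsum (weights R f) S = wsum (fun j => (load f j)%:R) (s @: S).
Proof.
have [s ws] := weights_perm R f; exists s => S.
by rewrite /wsum big_imset => [|? ? _ _ /perm_inj//]; apply: eq_bigr.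
Qed.

Theorem theorem4p1 (R : realType) (m n : nat) (hm : (0 < m)%N) (hn : (0 < n)%N)
    (q : R) (hq0 : 0 < q) (hqm : q <= m%:R)
    (hq : let M : R := m%:R / (3 * n%:R ^+ 3) in
      forall l : int,
        (1 / Num.sqrt M) * (m%:R / n%:R) < `|q - l%:~R * m%:R / n%:R|) :
  1 - 2 * (2 / expR 1) ^+ n <=
    Pr R (fun f : outcome m n =>
            [forall i : 'I_n, shapley (weights R f) q i == 1 / n%:R]).
Proof.
have m0 : 0 < m%:R :> R by rewrite ltr0n.
have n0 : 0 < n%:R :> R by rewrite ltr0n.
move: hq; set M := _ / _ => /=.
have M0 : 0 < M by rewrite divr_gt0 ?mulr_gt0 ?exprn_gt0.
set d : R := _ * (m%:R / n%:R) => hq.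
have d0 : 0 <= d by rewrite mulr_ge0 ?divr_ge0 ?sqrtr_ge0 ?ler0n.
have d2 : d ^+ 2 = 3 * n%:R * m%:R.
  rewrite /d exprMn expr_div_n sqr_sqrtr ?ltW // /M.
  by field; rewrite !gt_eqF.
clearbody d.
(* The hypothesis at [l = 0] gives [d < q]. *)
have dm : d <= m%:R.
  by have := hq 0; rewrite !mul0r subr0 gtr0_norm // => /ltW/le_trans; apply.
pose bad (S : {set 'I_n}) (f : outcome m n) :=
  #|S|%:R * m%:R / n%:R + d <= wsum (fun j => (load f j)%:R) S.
have bad_le : Pr R (fun f => [exists S, bad S f]) <= (2 / expR 1) ^+ n.
  apply: le_trans (Pr_exists_le _ _) _.
  apply: (@le_trans _ _ (\sum_(S : {set 'I_n}) expR (- n%:R))).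
    by apply: ler_sum => S _; exact: load_upper_tail.
  rewrite sumr_const -cardsT -powersetT card_powerset cardsT card_ord.
  by rewrite expr_div_n -expRM_natl mulr1 expRN -[leLHS]mulr_natl natrX.
rewrite PrC // lerD2l lerN2.
apply: (@le_trans _ _ ((2 / expR 1) ^+ n)); last first.
  by rewrite ler_peMl ?exprn_ge0 ?divr_ge0 ?expR_ge0 ?ler1n.
apply: le_trans bad_le; apply: le_Pr => f /=.
apply: contraR => /existsPn good; apply/forallP => i; apply/eqP.
have upper S : wsum (fun j => (load f j)%:R) S < #|S|%:R * m%:R / n%:R + d.
  by rewrite ltNge; exact: good.
(* A load too small on [S] would be a load too large on its complement. *)
have lower (S : {set 'I_n}) :
    #|S|%:R * m%:R / n%:R - d < wsum (fun j => (load f j)%:R) S.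
  have := upper (~: S); have := wsum_load_setC R f S.
  have -> : #|~: S|%:R = n%:R - #|S|%:R :> R.
    by rewrite cardsCs setCK card_ord natrB // -[leqRHS]card_ord max_card.
  rewrite 2!mulrBl mulrAC divff ?gt_eqF // mul1r.
  set x := wsum _ S; set y := wsum _ _; set z := #|S|%:R * _ / _; lra.
have [s ws] := wsum_weights R f.
(* The game is compared with the one in which [k] agents weigh exactly [k * m / n]; as [0 < q <= m],
   the empty coalition loses and the full one wins, so [g n - g 0 = 1]. *)
rewrite (@shapley_symmetric _ _ _ _
  (fun k => if q <= k%:R * m%:R / n%:R then 1 else 0)) => [|S].
  by rewrite [n%:R * _]mulrC mulfK ?gt_eqF // hqm !mul0r leNgt hq0 subr0.
rewrite /value /winning ws.
have := upper (s @: S); have := lower (s @: S).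
rewrite card_imset; last exact: perm_inj.
(* At [l = #|S|] the quota is further than [d] from [x], whereas [y] is within [d] of [x]; hence [q]
   cannot separate [x] from [y]. *)
have := hq #|S|%:Z; rewrite -pmulrn.
set x := #|S|%:R * _ / _; set y := wsum _ _; rewrite ltr_normr => hx hl hu.
by case: (leP q x) hx; case: (leP q y) => // h1 h2 /orP[] h3; exfalso; lra.
Qed.
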